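(* Assume the following. (i) $F$ is continuous with continuous Fréchet derivative satisfying $\|F'(x)\|\le 1$ for all $x\in B_r(\bar x)$. (ii) There is $\eta\in(0,1)$ such that $\|F(\tilde x)-F(x)-F'(x)(\tilde x-x)\|\le \eta\|F(x)-F(\tilde x)\|$ for all $x,\tilde x\in B_r(\bar x)\subset \mathcal{D}(F)$. Let $x(t)$ be the solution of the stochastic initial value problem of the context with exact data $y$ (i.e. with $\delta=0$ and $y^\delta=y$), and let $x^*$ be a solution of $F(x)=y$. Then $$\lim_{t\to\infty}\mathbb{E}\big[\|x(t)-x^*\|^2\big]=0.$$ If in addition $\mathcal{N}(F'(x^\dagger))\subset\mathcal{N}(F'(x(t)))$ for all $t>0$, then $$\lim_{t\to\infty}\mathbb{E}\big[\|x(t)-x^\dagger\|^2\big]=0.$$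
   Context: $\mathcal{X},\mathcal{Y}$ are separable Hilbert spaces; $\|\cdot\|$ denotes all norms (including operator norms). $F:\mathcal{D}(F)\subset\mathcal{X}\to\mathcal{Y}$ is a nonlinear operator with Fréchet derivative $F'(x)$ and adjoint $F'(x)^*$; $y\in\mathcal{Y}$ is the exact data. $\bar x\in\mathcal{X}$ is a non-random initial guess, $B_r(\bar x)$ is the closed ball of radius $r$ around $\bar x$, and $\mathcal{N}(\cdot)$ denotes the null space. $x^\dagger$ denotes the unique solution of $F(x)=y$ of minimal distance to $\bar x$. Noise model: $y^\delta\in\mathcal{Y}$, $\|y^\delta-y\|\le\delta$, $\delta\in(0,\delta_0]$ with $\delta_0>0$ fixed; $\delta=0$ corresponds to exact data $y^\delta=y$. Stochastic initial value problem (stochastic asymptotical regularization): $$\mathrm{d}x^\delta(t)=F'(x^\delta(t))^*[y^\delta-F(x^\delta(t))]\,\mathrm{d}t+f(t)\,\mathrm{d}B_t,\qquad x^\delta(0)=\bar x,$$ where $f(t)=\delta\,\big(\mathbb{E}[\|F(x^\delta(t))-y^\delta\|^2]\big)^{1/2}g(t)$ and $g:[0,\infty)\to\mathbb{R}$ is a monotonically decreasing function with $\lim_{t\to\infty}g(t)=0$, $g(0)=\sqrt{\epsilon_0\eta}/\delta_0$, $\epsilon_0\in(0,2(1/\eta-1))$. $B_t$ is an $\mathcal{X}$-valued $\mathcal{Q}$-Wiener process: $\mathcal{Q}$ is a symmetric nonnegative definite trace-class operator on $\mathcal{X}$ with eigenvalues $\lambda_j>0$ and orthonormal eigenbasis $\{\varphi_j\}$,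 and $B_t=\sum_j\lambda_j^{1/2}\beta_j(t)\varphi_j$ with independent Brownian motions $\beta_j$ on a filtered probability space. For $\delta=0$ the solution is written $x(t)$.
   Formalization: It is assumed in addition that x† lies in B_r(x̄) and that x(t) stays in B_r(x̄) almost surely for all t; x* is some solution of F(x)=y (not an arbitrary one), and ''the solution'' x(t) means unique up to indistinguishability. *)

(* Defs.v *)
From HB Require Import structures.
From mathcomp Require Import all_boot all_order all_algebra.
From mathcomp Require Import all_classical all_reals all_analysis.

Set Implicit Arguments.
Unset Strict Implicit.
Unset Printing Implicit Defensive.
Import Order.TTheory GRing.Theory Num.Theory.
Import numFieldNormedType.Exports.

Local Open Scope classical_set_scope.
Local Open Scope ring_scope.

(* A real Hilbert space is a completeNormedModType whose norm comes from an
   inner product; by polarization the inner product is determined by the norm. *)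
Record inner_product (R : realType) (X : normedModType R) := InnerProduct {
  ip :> X -> X -> R ;
  ip_sym : forall u v, ip u v = ip v u ;
  ip_linear : forall (a : R) u v w, ip (a *: u + v) w = a * ip u w + ip v w ;
  ip_norm : forall u, ip u u = `|u| ^+ 2 }.

Definition separable (T : topologicalType) : Prop :=
  exists2 A : set T, countable A & dense A.

(* For a continuous linear L between Hilbert spaces the vector selected here
   exists and is unique, by Riesz. *)
Definition adjoint (R : realType) (X Y : normedModType R)
    (ipX : inner_product X) (ipY : inner_product Y) (L : X -> Y) (k : Y) : X :=
  xget 0 [set v | forall h, ipX h v = ipY (L h) k].

(* Meaningful for bounded linear L only: the real-valued sup is 0 on
   unbounded sets. *)
Definition opnorm (R : realType) (X Y : normedModType R) (L : X -> Y) : R :=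
  sup [set `|L h| | h in [set h : X | `|h| <= 1]].

Definition null_space (R : realType) (X Y : normedModType R) (L : X -> Y) :
  set X := [set h | L h = 0].

Definition continuous_derivative_on (R : realType) (X Y : normedModType R)
    (A : set X) (F : X -> Y) : Prop :=
  (forall x, A x -> differentiable F x) /\
  (forall x, A x ->
     opnorm (fun h => 'd F z h - 'd F x h) @[z --> within A (nbhs x)] --> (0 : R)).

Definition tangential_cone (R : realType) (X Y : normedModType R)
    (A : set X) (F : X -> Y) (eta : R) : Prop :=
  forall x x', A x -> A x' ->
    `|F x' - F x - 'd F x (x' - x)| <= eta * `|F x - F x'|.

Definition is_solution (X Y : Type) (D : set X) (F : X -> Y) (y : Y) (x : X) :
  Prop := D x /\ F x = y.

Definition unique_min_distance_solution (R : realType) (X : normedModType R)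
    (Y : Type) (D : set X) (F : X -> Y) (y : Y) (xbar xdag : X) : Prop :=
  is_solution D F y xdag /\
  forall z, is_solution D F y z -> z <> xdag -> `|xdag - xbar| < `|z - xbar|.

(* The X-valued simple function coded by s is the sum of a * 1_A over the pairs
   (A, a) in s. *)
Definition simple_val (R : realType) (X : normedModType R)
    (s : seq (set R * X)) (u : R) : X := \sum_(p <- s) (\1_(p.1) u : R) *: p.2.

Definition simple_int (R : realType) (X : normedModType R)
    (s : seq (set R * X)) : X :=
  \sum_(p <- s) (fine (@lebesgue_measure R p.1)) *: p.2.

(* f is Bochner integrable over `[0, t], with integral v. *)
Definition has_bochner_integral (R : realType) (X : normedModType R)
    (t : R) (f : R -> X) (v : X) : Prop :=
  exists s : nat -> seq (set R * X),
    [/\ forall n p, p \in s n -> measurable p.1 /\ p.1 `<=` `[0, t],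
        forall n, measurable_fun `[0, t] (fun u => `|f u - simple_val (s n) u|),
        (\int[lebesgue_measure]_(u in `[0%R, t])
           (`|f u - simple_val (s n) u|)%:E)%E @[n --> \oo] --> 0%E &
        simple_int (s n) @[n --> \oo] --> v].

Section probability.
Context (R : realType) (d : measure_display) (Omega : measurableType d)
        (P : probability Omega R).

Definition filtration (Fil : R -> set (set Omega)) : Prop :=
  (forall t, 0 <= t ->
     sigma_algebra setT (Fil t) /\ (forall A, Fil t A -> measurable A)) /\
  (forall s t, 0 <= s -> s <= t -> Fil s `<=` Fil t).

(* Borel measurability of Z : Omega -> X with respect to G. *)
Definition borel_measurable (X : topologicalType) (G : set (set Omega))
    (Z : Omega -> X) : Prop := forall U, open U -> G (Z @^-1` U).

Definition adapted (X : topologicalType) (Fil : R -> set (set Omega))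
    (Z : R -> Omega -> X) : Prop :=
  forall t, 0 <= t -> borel_measurable (Fil t) (Z t).

Definition continuous_paths (X : topologicalType) (Z : R -> Omega -> X) :
  Prop := {ae P, forall w, {within `[0, +oo[, continuous (fun t => Z t w)}}.

Definition generated_sigma (I : Type) (D : set I) (Z : I -> Omega -> R) :
    set (set Omega) :=
  <<s [set A | exists i (U : set R), [/\ D i, measurable U & A = Z i @^-1` U]] >>.

Definition independent2 (G H : set (set Omega)) : Prop :=
  forall A B, G A -> H B -> P (A `&` B) = (P A * P B)%E.

Definition mutually_independent (J : set nat) (G : nat -> set (set Omega)) :
    Prop :=
  forall (K : seq nat) (A : nat -> set Omega), uniq K ->
    (forall j, j \in K -> J j /\ G j (A j)) ->
    P (\bigcap_(j in [set` K]) A j) = (\prod_(j <- K) P (A j))%E.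

Record brownian_motion (Fil : R -> set (set Omega)) (beta : R -> Omega -> R) :
    Prop := BrownianMotion {
  bm_adapted : adapted Fil beta ;
  bm_start : {ae P, forall w, beta 0 w = 0} ;
  bm_continuous : continuous_paths beta ;
  bm_normal : forall s t, 0 <= s -> s < t -> forall U : set R, measurable U ->
    P [set w | U (beta t w - beta s w)] = normal_prob 0 (Num.sqrt (t - s)) U ;
  bm_indep : forall s, 0 <= s ->
    independent2 (Fil s)
      (generated_sigma [set t | s <= t] (fun t w => beta t w - beta s w)) }.

(* The eigenbasis is indexed by a set J of naturals, so that finite-dimensional
   X is allowed. *)
Record trace_class_eigenbasis (X : normedModType R) (ipX : inner_product X)
    (Q : {linear X -> X}) (J : set nat) (lambda : nat -> R) (phi : nat -> X) :
    Prop := TraceClassEigenbasis {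
  tc_sym : forall u v, ipX (Q u) v = ipX u (Q v) ;
  tc_nneg : forall u, 0 <= ipX (Q u) u ;
  tc_eigen : forall j, J j -> Q (phi j) = lambda j *: phi j ;
  tc_pos : forall j, J j -> 0 < lambda j ;
  tc_orthonormal : forall i j, J i -> J j -> ipX (phi i) (phi j) = (i == j)%:R ;
  tc_basis : forall u : X,
    (\sum_(0 <= j < n | j \in J) ipX u (phi j) *: phi j) @[n --> \oo] --> u ;
  tc_trace : (\sum_(0 <= j <oo | j \in J) (lambda j)%:E < +oo)%E }.

(* The series defining B t is taken in L^2(Omega; X). *)
Record q_wiener_process (X : normedModType R) (ipX : inner_product X)
    (Fil : R -> set (set Omega)) (Q : {linear X -> X}) (J : set nat)
    (lambda : nat -> R) (phi : nat -> X) (beta : nat -> R -> Omega -> R)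
    (B : R -> Omega -> X) : Prop := QWienerProcess {
  qw_eigenbasis : trace_class_eigenbasis ipX Q J lambda phi ;
  qw_brownian : forall j, J j -> brownian_motion Fil (beta j) ;
  qw_indep : mutually_independent J
    (fun j => generated_sigma [set t | 0 <= t] (beta j)) ;
  qw_increments : forall s, 0 <= s ->
    independent2 (Fil s)
      (generated_sigma [set p : nat * R | J p.1 /\ s <= p.2]
         (fun p w => beta p.1 p.2 w - beta p.1 s w)) ;
  qw_adapted : adapted Fil B ;
  qw_continuous : continuous_paths B ;
  qw_series : forall t, 0 <= t ->
    expectation P (fun w => `|B t w - \sum_(0 <= j < n | j \in J)
                      (Num.sqrt (lambda j) * beta j t w) *: phi j| ^+ 2)
      @[n --> \oo] --> 0%E }.

(* The step function coded by s is the sum of c * 1_]a, b] over the triples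
   (a, b, c) in s. *)
Definition step_val (s : seq (R * R * R)) (u : R) : R :=
  \sum_(p <- s) p.2 * (\1_(`]p.1.1, p.1.2]%classic) u : R).

Definition step_int (X : normedModType R) (B : R -> Omega -> X)
    (s : seq (R * R * R)) (w : Omega) : X :=
  \sum_(p <- s) p.2 *: (B p.1.2 w - B p.1.1 w).

(* S is the Ito integral over [0, t] of the deterministic integrand f against
   B: the L^2(Omega; X)-limit of the integrals of any sequence of step functions
   approximating f in L^2(0, t). *)
Definition is_wiener_integral (X : normedModType R) (B : R -> Omega -> X)
    (t : R) (f : R -> R) (S : Omega -> X) : Prop :=
  [/\ borel_measurable (@measurable _ Omega) S,
      measurable_fun `[0, t] f,
      (\int[lebesgue_measure]_(u in `[0%R, t]) ((f u) ^+ 2)%:E < +oo)%E &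
      forall s : nat -> seq (R * R * R),
        (forall n p, p \in s n -> 0 <= p.1.1 <= p.1.2 /\ p.1.2 <= t) ->
        (\int[lebesgue_measure]_(u in `[0%R, t])
           ((f u - step_val (s n) u) ^+ 2)%:E)%E @[n --> \oo] --> 0%E ->
        expectation P (fun w => `|S w - step_int B (s n) w| ^+ 2)
          @[n --> \oo] --> 0%E].

Definition noise_intensity (X Y : normedModType R) (F : X -> Y) (delta : R)
    (ydelta : Y) (g : R -> R) (x : R -> Omega -> X) (t : R) : R :=
  delta * Num.sqrt (fine (expectation P (fun w => `|F (x t w) - ydelta| ^+ 2))) * g t.

(* Solutions take their values in the ball B_r(xbar), on which F' is given. *)
Record sar_solution (X Y : normedModType R) (ipX : inner_product X)
    (ipY : inner_product Y) (Fil : R -> set (set Omega)) (B : R -> Omega -> X)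
    (F : X -> Y) (xbar : X) (r : R) (g : R -> R) (delta : R) (ydelta : Y)
    (x : R -> Omega -> X) : Prop := SarSolution {
  sar_adapted : adapted Fil x ;
  sar_continuous : continuous_paths x ;
  sar_ball : {ae P, forall w, forall t, 0 <= t -> closed_ball xbar r (x t w)} ;
  sar_equation : exists S : R -> Omega -> X,
    (forall t, 0 <= t ->
       is_wiener_integral B t (noise_intensity F delta ydelta g x) (S t)) /\
    {ae P, forall w, forall t, 0 <= t ->
       has_bochner_integral t
         (fun s => adjoint ipX ipY ('d F (x s w)) (ydelta - F (x s w)))
         (x t w - xbar - S t w)} }.

(* "The" solution: uniqueness up to indistinguishability. *)
Definition the_sar_solution (X Y : normedModType R) (ipX : inner_product X)
    (ipY : inner_product Y) (Fil : R -> set (set Omega)) (B : R -> Omega -> X)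
    (F : X -> Y) (xbar : X) (r : R) (g : R -> R) (delta : R) (ydelta : Y)
    (x : R -> Omega -> X) : Prop :=
  sar_solution ipX ipY Fil B F xbar r g delta ydelta x /\
  forall z, sar_solution ipX ipY Fil B F xbar r g delta ydelta z ->
    {ae P, forall w, forall t, 0 <= t -> x t w = z t w}.

End probability.

(* Main.v *)
(* For exact data the noise intensity vanishes, so the stochastic term is zero
   almost surely and almost every path solves the integral form of
     x' = F'(x)^* (y - F x),  x(0) = xbar.
   A single good path, viewed as a process that does not depend on the outcome,
   is again a solution; hence by uniqueness x is almost surely deterministic.

   For this flow put e = y - F x and V = |x - z|^2 with z a solution in the ball.
   The cone condition gives V' <= -2 (1 - eta) |e|^2, and |e| is nonincreasing,
   so t |e(t)|^2 stays bounded and e -> 0. Since |F'(x(u)) (x(t) - z)| is bounded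
   by a multiple of |e(u)| for u <= t, |x(t) - x(s)|^2 is bounded by a multiple of
   V(s) - V(t); as V is nonincreasing, x(t) is Cauchy, and its limit solves F = y.

   Under the null space condition x(t) - xbar stays orthogonal to N(F'(xdag)),
   whereas the cone condition puts xstar - xdag into N(F'(xdag)). Hence
   |xstar - xbar| <= |xdag - xbar|, and xstar = xdag by minimality. *)

Require Import Defs.
From mathcomp Require Import all_boot all_order all_algebra.
From mathcomp Require Import all_classical all_reals all_analysis.
From mathcomp Require Import measurable_realfun ring lra.
Import Order.TTheory GRing.Theory Num.Theory.
Import numFieldNormedType.Exports.
Local Open Scope classical_set_scope.
Local Open Scope ring_scope.

(** * Inner product calculus: Cauchy-Schwarz, continuity, product rule *)

Section InnerProduct.
Context {R : realType} {X : normedModType R} (ipX : inner_product X).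
Implicit Types u v w : X.

Lemma ip0l w : ipX 0 w = 0.
Proof.
have := ip_linear ipX 1 0 0 w; rewrite scale1r addr0 mul1r => /eqP.
by rewrite -subr_eq subrr eq_sym => /eqP.
Qed.

Lemma ipZl (a : R) u w : ipX (a *: u) w = a * ipX u w.
Proof. by have := ip_linear ipX a u 0 w; rewrite !addr0 ip0l addr0. Qed.

Lemma ipDl u v w : ipX (u + v) w = ipX u w + ipX v w.
Proof. by have := ip_linear ipX 1 u v w; rewrite scale1r mul1r. Qed.

Lemma ipNl u w : ipX (- u) w = - ipX u w.
Proof. by rewrite -scaleN1r ipZl mulN1r. Qed.

Lemma ipBl u v w : ipX (u - v) w = ipX u w - ipX v w.
Proof. by rewrite ipDl ipNl. Qed.

Lemma ip0r w : ipX w 0 = 0.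
Proof. by rewrite ip_sym ip0l. Qed.

Lemma ipZr (a : R) u w : ipX w (a *: u) = a * ipX w u.
Proof. by rewrite ip_sym ipZl ip_sym. Qed.

Lemma ipDr u v w : ipX w (u + v) = ipX w u + ipX w v.
Proof. by rewrite ip_sym ipDl ip_sym (ip_sym ipX w v). Qed.

Lemma ipBr u v w : ipX w (u - v) = ipX w u - ipX w v.
Proof. by rewrite ip_sym ipBl ip_sym (ip_sym ipX w v). Qed.

Lemma normD_sqr u v : `|u + v| ^+ 2 = `|u| ^+ 2 + 2 * ipX u v + `|v| ^+ 2.
Proof.
by rewrite -!(ip_norm ipX) !ipDl !ipDr (ip_sym ipX v u); ring.
Qed.

(* The triangle inequality is already part of the normed structure, so that
   expanding [|u + v|^2 <= (|u| + |v|)^2] gives the Cauchy-Schwarz inequality. *)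
Lemma ip_le u v : ipX u v <= `|u| * `|v|.
Proof.
have : `|u + v| ^+ 2 <= (`|u| + `|v|) ^+ 2 by rewrite lerXn2r ?nnegrE ?addr_ge0 ?ler_normD.
by rewrite normD_sqr sqrrD; lra.
Qed.

Lemma normr_ip u v : `|ipX u v| <= `|u| * `|v|.
Proof.
by rewrite ler_norml ip_le andbT lerNl -ipNl (le_trans (ip_le _ _)) ?normrN.
Qed.

(** Take [h = u]. This lets vector estimates be proved on scalars: pair with an arbitrary [h],
    bound, then drop [h]. *)
Lemma norm_le_ip (c : R) u :
  0 <= c -> (forall h, `|ipX u h| <= c * `|h|) -> `|u| <= c.
Proof.
move=> c0 /(_ u); rewrite ip_norm normrX normr_id expr2.
have [->|u0] := eqVneq u 0; first by rewrite normr0.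
by rewrite ler_pM2r// normr_gt0.
Qed.

Lemma cvg_ip {T : Type} {G : set_system T} {FG : Filter G} (f g : T -> X) u v :
  f @ G --> u -> g @ G --> v -> ipX (f x) (g x) @[x --> G] --> ipX u v.
Proof.
move=> fu gv; apply/cvgrPdist_le => /= e e0.
have e1 : 0 < e / (2 * (`|v| + 1)) by rewrite divr_gt0// mulr_gt0// ltr_wpDl.
have e2 : 0 < e / (2 * (`|u| + 1)) by rewrite divr_gt0// mulr_gt0// ltr_wpDl.
move/cvgrPdist_le : (fu) => /(_ _ e1) fu1.
move/cvgrPdist_le : (gv) => /(_ _ e2) gv1.
move/cvgrPdist_le : gv => /(_ _ ltr01) gv2.
near=> x.
have H1 : `|u - f x| <= e / (2 * (`|v| + 1)) by near: x.
have H2 : `|v - g x| <= e / (2 * (`|u| + 1)) by near: x.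
have H3 : `|g x| <= `|v| + 1.
  rewrite (_ : g x = v - (v - g x)); last by rewrite subKr.
  by rewrite (le_trans (ler_normB _ _))// lerD2l; near: x.
rewrite (_ : _ - _ = ipX (u - f x) (g x) + ipX u (v - g x)); last first.
  by rewrite ipBl ipBr; ring.
rewrite (le_trans (ler_normD _ _))// [leRHS]splitr lerD//.
  rewrite (le_trans (normr_ip _ _))// (le_trans (ler_pM _ _ H1 H3))//.
  by rewrite invfM mulrA mulfVK// gt_eqF// ltr_wpDl.
rewrite (le_trans (normr_ip _ _))//.
rewrite (@le_trans _ _ ((`|u| + 1) * (e / (2 * (`|u| + 1)))))//.
  by rewrite ler_pM// lerDl.
by rewrite mulrC invfM mulrA mulfVK// gt_eqF// ltr_wpDl.
Unshelve. all: by end_near. Qed.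

Lemma is_derive_ip {f g : R -> X} {t : R} {df dg : X} :
  is_derive t 1 f df -> is_derive t 1 g dg ->
  is_derive t 1 (fun s => ipX (f s) (g s)) (ipX df (g t) + ipX (f t) dg).
Proof.
move=> [fd fE] [gd gE].
have gc : {for t, continuous g} by apply/differentiable_continuous/derivable1_diffP.
have gc0 : g (h *: 1 + t) @[h --> 0^'] --> g t.
  have ht0 : h *: 1 + t @[h --> 0^'] --> t.
    rewrite -[X in _ --> X](add0r t); apply: cvgD; last exact: cvg_cst.
    have -> : (fun h : R => h *: (1 : R)) = id.
      by apply/funext => h; rewrite /GRing.scale/= mulr1.
    exact: nbhs_dnbhs.
  exact: (cvg_comp (fun h : R => h *: 1 + t) g ht0 gc).
have lim : h^-1 *: (((fun s => ipX (f s) (g s)) \o shift t) (h *: 1) - ipX (f t) (g t))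
     @[h --> 0^'] --> ipX df (g t) + ipX (f t) dg.
  (* The increment is split as [f] moving against the shifted [g], plus [f t] against [g] moving.
     Continuity of [g] at [t] handles the shifted factor. *)
  have -> : (fun h : R => h^-1 *: (((fun s => ipX (f s) (g s)) \o shift t) (h *: 1) -
       ipX (f t) (g t))) =
     (fun h => ipX (h^-1 *: (f (h *: 1 + t) - f t)) (g (h *: 1 + t)) +
       ipX (f t) (h^-1 *: (g (h *: 1 + t) - g t))).
    apply/funext => h; rewrite /= ipZl ipZr -mulrDr ipBl ipBr.
    by rewrite addrA subrK.
  apply: cvgD; apply: cvg_ip => //.
  - by rewrite -fE; exact: fd.
  - exact: cvg_cst.
  - by rewrite -gE; exact: gd.
by split; [apply: cvgP lim | exact: cvg_lim lim].
Qed.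

End InnerProduct.

(** * Operator norm bounds *)

Section Operators.
Context {R : realType} {X Y : normedModType R}.

Lemma continuous_linear_bound {L : {linear X -> Y}} : continuous L ->
  exists M, forall h, `|h| <= 1 -> `|L h| <= M.
Proof. by move=> /linear_bounded_continuous/bounded_funP/(_ 1). Qed.

Lemma opnorm_ge0 (L : X -> Y) : 0 <= opnorm L.
Proof.
rewrite /opnorm; set A := [set _ | _ in _].
have [As|As] := pselect (has_sup A); last by rewrite sup_out.
apply: (@le_trans _ _ `|L 0|) => //; apply: sup_upper_bound => //.
by exists 0 => //=; rewrite normr0.
Qed.

(** Scale [h] to norm 1. The bound on the unit ball makes [opnorm] a genuine supremum, since [sup]
    is 0 on unbounded sets. *)
Lemma le_opnorm {L : X -> Y} h : (forall (a : R) u, L (a *: u) = a *: L u) ->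
  (exists M, forall u, `|u| <= 1 -> `|L u| <= M) ->
  `|L h| <= opnorm L * `|h|.
Proof.
move=> LZ [M LM]; have [->|h0] := eqVneq h 0.
  have := LZ 0 0; rewrite !scale0r => ->.
  by rewrite !normr0 mulr0.
rewrite -ler_pdivrMr ?normr_gt0//.
apply: (@sup_upper_bound R [set `|L u| | u in [set u : X | `|u| <= 1]]).
  split; first by exists `|L 0|, 0 => //=; rewrite normr0.
  by exists M => _ [u u1 <-]; exact: LM.
exists (`|h|^-1 *: h) => /=.
  by rewrite normrZ normfV normr_id mulVf// normr_eq0.
by rewrite LZ normrZ normfV normr_id mulrC.
Qed.

End Operators.

(** * Riesz representation and the adjoint *)

Section Riesz.
Context {R : realType} {X : completeNormedModType R} (ipX : inner_product X).

(* An approximate minimiser [v] of [J v = |v|^2 / 2 - l v] represents [l] up to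
   a small error, because [J (v + s *: h) - J v] cannot be very negative. *)
Lemma approximate_riesz {l : X -> R} {c e : R} :
  (forall (a : R) u v, l (a *: u + v) = a * l u + l v) ->
  (forall h, `|l h| <= c * `|h|) -> 0 < e ->
  exists v, forall h, `|ipX v h - l h| <= e * `|h|.
Proof.
move=> llin lc e0.
pose J v : R := `|v| ^+ 2 / 2 - l v.
have Jinf : has_inf (range J).
  split; first by exists (J 0), 0.
  (* The minimum of [a ^+ 2 / 2 - c * a], with [a] standing for the norm of [v]. *)
  exists (- c ^+ 2 / 2) => _ [v _ <-]; rewrite /J.
  have := ler_norm (l v); have := lc v; have := sqr_ge0 (`|v| - c).
  by move=> h1 h2 h3; nra.
have e2 : 0 < e ^+ 2 / 2 by rewrite divr_gt0// exprn_gt0.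
have [_ [v _ <-] Jv] := inf_adherent e2 Jinf.
exists v => h; have [->|h0] := eqVneq h 0.
  have l0 : l 0 = 0 by have := llin 1 0 0; rewrite scale1r addr0 mul1r => h1; lra.
  by rewrite ip0r l0 subrr !normr0 mulr0.
have hp : 0 < `|h| ^+ 2 by rewrite exprn_gt0// normr_gt0.
set a := ipX v h - l h.
(* The minimiser of the quadratic [J (v + s *: h) = J v + s * a + s ^+ 2 * |h| ^+ 2 / 2]. *)
pose s := - (a / `|h| ^+ 2).
have sh : s * `|h| ^+ 2 = - a by rewrite /s mulNr divfK// gt_eqF.
have Jmin : inf (range J) <=
    (`|v| ^+ 2 + 2 * (s * ipX v h) + s ^+ 2 * `|h| ^+ 2) / 2 - (s * l h + l v).
  have -> : s ^+ 2 * `|h| ^+ 2 = `|s *: h| ^+ 2 by rewrite normrZ exprMn real_normK ?num_real.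
  rewrite -ipZr -normD_sqr -llin addrC.
  by apply: ge_inf; [exact: Jinf.2|exists (s *: h + v) => //; rewrite /J addrC [v + _]addrC].
have as2 : a * s <= - (s ^+ 2 * `|h| ^+ 2).
  have -> : s ^+ 2 * `|h| ^+ 2 = s * (s * `|h| ^+ 2) by ring.
  by rewrite sh; lra.
have vh : ipX v h = a + l h by rewrite subrK.
have key : - s * a < e ^+ 2.
  by move: Jv Jmin; rewrite /J vh => h1 h2; nra.
rewrite -(@ler_pXn2r _ 2) ?nnegrE ?mulr_ge0 ?(ltW e0)//.
rewrite real_normK ?num_real// exprMn.
have -> : a ^+ 2 = (- s * a) * `|h| ^+ 2 by rewrite mulrAC mulNr sh opprK.
by rewrite ler_pM2r// ltW.
Qed.

(** Representers with error [harmonic n] differ pairwise by at most the sum of their errors, so they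
    form a Cauchy sequence; the limit supplied by completeness represents [l] exactly. *)
Lemma riesz (l : X -> R) (c : R) :
  (forall (a : R) u v, l (a *: u + v) = a * l u + l v) ->
  (forall h, `|l h| <= c * `|h|) -> exists v, forall h, ipX v h = l h.
Proof.
move=> llin lc.
have [v vl] := choice (fun n : nat => approximate_riesz llin lc (harmonic_gt0 n)).
have vB n m : `|v n - v m| <= harmonic n + harmonic m.
  apply: (norm_le_ip ipX); first by rewrite addr_ge0// harmonic_ge0.
  move=> h; rewrite ipBl mulrDl.
  rewrite (_ : _ - _ = (ipX (v n) h - l h) - (ipX (v m) h - l h)); last by ring.
  by rewrite (le_trans (ler_normB _ _))// lerD.
have vcvg : cvgn v.
  apply: cauchy_cvg; apply: cauchy_exP => e e0.
  have e2 : 0 < e / 2 by rewrite divr_gt0.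
  have /cvgrPdist_lt /(_ _ e2) [N _ HN] := @cvg_harmonic R.
  have {}HN n : (N <= n)%N -> harmonic n < e / 2.
    by move=> /HN; rewrite /= sub0r normrN ger0_norm// harmonic_ge0.
  exists (v N); exists N => // n /= Nn; rewrite -ball_normE/=.
  by rewrite (le_lt_trans (vB _ _))// [ltRHS]splitr ltrD// HN.
exists (lim (v @ \oo)) => h.
have h1 : ipX (v n) h @[n --> \oo] --> ipX (lim (v @ \oo)) h.
  by apply: cvg_ip => //; exact: cvg_cst.
apply: (cvg_unique _ h1) => //.
apply/cvgrPdist_le => e e0.
have : harmonic n * `|h| @[n --> \oo] --> (0 : R).
  by rewrite -(mul0r `|h|); apply: cvgMl; exact: cvg_harmonic.
move=> /cvgrPdist_le /(_ _ e0); apply: filterS => n.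
rewrite sub0r normrN ger0_norm ?mulr_ge0 ?harmonic_ge0//.
by rewrite distrC; exact/le_trans/vl.
Qed.

End Riesz.

(** [adjoint] is an [xget] with default 0, so its defining property holds only once a witness
    exists. Riesz supplies one, applied to the functional pairing [L u] with [k]. *)
Lemma adjointP {R : realType} {X : completeNormedModType R} {Y : normedModType R}
  (ipX : inner_product X) (ipY : inner_product Y) (L : {linear X -> Y}) k h :
  continuous L -> ipX h (adjoint ipX ipY L k) = ipY (L h) k.
Proof.
move=> /continuous_linear_bound LM.
suff [v vP] : exists v, forall h, ipX v h = ipY (L h) k.
  have : [set v | forall h, ipX h v = ipY (L h) k] (adjoint ipX ipY L k).
    by apply: xgetPex; exists v => u; rewrite ip_sym.
  exact.
apply: (@riesz _ _ _ _ (opnorm L * `|k|)) => [a u v|u].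
  by rewrite linearP ip_linear.
rewrite (le_trans (normr_ip _ _ _))// mulrAC ler_wpM2r//.
by apply: le_opnorm => // a w; rewrite linearZ.
Qed.

(** * Pairing integrals of simple functions with a fixed vector *)

Lemma integrable_addr {d} {T : measurableType d} {R : realType}
    {mu : {measure set T -> \bar R}} {D : set T} {f1 f2 : T -> R} :
  measurable D ->
  mu.-integrable D (EFin \o f1) -> mu.-integrable D (EFin \o f2) ->
  mu.-integrable D (EFin \o (fun u => f1 u + f2 u)).
Proof.
move=> mD if1 if2; have := integrableD mD if1 if2.
by apply: eq_integrable => // u _; rewrite /= EFinD.
Qed.

Lemma integrable_subr {d} {T : measurableType d} {R : realType}
    {mu : {measure set T -> \bar R}} {D : set T} {f1 f2 : T -> R} :
  measurable D ->
  mu.-integrable D (EFin \o f1) -> mu.-integrable D (EFin \o f2) ->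
  mu.-integrable D (EFin \o (fun u => f1 u - f2 u)).
Proof.
move=> mD if1 if2; have := integrableB mD if1 if2.
by apply: eq_integrable => // u _; rewrite /= EFinB.
Qed.

Section SimpleIntegral.
Context {d : measure_display} {T : measurableType d} {R : realType}
  {mu : {measure set T -> \bar R}} {X : normedModType R} (ipX : inner_product X).
Context {D : set T} (mD : measurable D) (Dfin : (mu D < +oo)%E).

Lemma ip_simple_integral {s : seq (set T * X)} h :
  (forall p, p \in s -> measurable p.1 /\ p.1 `<=` D) ->
  mu.-integrable D
    (EFin \o (fun u => ipX (\sum_(p <- s) (\1_(p.1) u : R) *: p.2) h)) /\
  \int[mu]_(u in D) ipX (\sum_(p <- s) (\1_(p.1) u : R) *: p.2) h =
    ipX (\sum_(p <- s) fine (mu p.1) *: p.2) h.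
Proof.
elim: s => [_|p s IHs sP].
  rewrite big_nil ip0l.
  under [X in EFin \o X]eq_fun do rewrite big_nil ip0l.
  under eq_Rintegral do rewrite big_nil ip0l.
  by split; [exact: integrable0|rewrite Rintegral_cst ?mul0r].
have [|ints intE] := IHs.
  by move=> q qs; apply: sP; rewrite inE qs orbT.
have [mp pD] := sP p (mem_head _ _).
have int1 : mu.-integrable D (EFin \o (fun u => \1_(p.1) u : R)).
  apply/integrableP; split; first exact/measurable_EFinP/measurable_indic.
  under eq_integral do rewrite /= ger0_norm//.
  rewrite integral_indic//; apply: le_lt_trans Dfin.
  by apply: le_measure; rewrite ?inE//; exact: measurableI.
have intp : mu.-integrable D (EFin \o (fun u => \1_(p.1) u * ipX p.2 h)).
  rewrite (_ : _ \o _ = fun u => ((ipX p.2 h)%:E * (\1_(p.1) u : R)%:E)%E).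
    exact: integrableZl.
  by apply/funext => u /=; rewrite mulrC EFinM.
have E u : ipX (\sum_(p <- p :: s) (\1_(p.1) u : R) *: p.2) h =
    \1_(p.1) u * ipX p.2 h + ipX (\sum_(p <- s) (\1_(p.1) u : R) *: p.2) h.
  by rewrite big_cons ipDl ipZl.
under [X in EFin \o X]eq_fun do rewrite E.
under eq_Rintegral do rewrite E.
split; first exact: integrable_addr.
rewrite RintegralD// intE RintegralZr// big_cons ipDl ipZl; congr (_ * _ + _).
by rewrite /Rintegral integral_indic// setIidl.
Qed.

(** By Cauchy-Schwarz, replacing [f] by its n-th simple approximation changes the paired integral by
    at most the norm of [h] times the L1 error, which tends to 0. *)
Lemma ip_simple_approx {f : T -> X} {s : nat -> seq (set T * X)} {v h : X} :
  mu.-integrable D (EFin \o (fun u => ipX (f u) h)) ->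
  (forall n p, p \in s n -> measurable p.1 /\ p.1 `<=` D) ->
  (forall n, measurable_fun D
     (fun u => `|f u - \sum_(p <- s n) (\1_(p.1) u : R) *: p.2|)) ->
  (\int[mu]_(u in D) (`|f u - \sum_(p <- s n) (\1_(p.1) u : R) *: p.2|)%:E)%E
    @[n --> \oo] --> 0%E ->
  \sum_(p <- s n) fine (mu p.1) *: p.2 @[n --> \oo] --> v ->
  ipX v h = \int[mu]_(u in D) ipX (f u) h.
Proof.
move=> intf sP sm slim svlim.
pose S n u : X := \sum_(p <- s n) (\1_(p.1) u : R) *: p.2.
have lim1 : ipX (\sum_(p <- s n) fine (mu p.1) *: p.2) h @[n --> \oo] --> ipX v h.
  by apply: cvg_ip => //; exact: cvg_cst.
apply: (cvg_unique _ lim1) => //.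
pose e n := (\int[mu]_(u in D) (`|f u - S n u|)%:E)%E.
have bnd n : (`|(\int[mu]_(u in D) ipX (f u) h -
    ipX (\sum_(p <- s n) fine (mu p.1) *: p.2) h)%:E| <= `|h|%:E * e n)%E.
  have [ints intE] := ip_simple_integral h (sP n); rewrite -intE.
  rewrite -RintegralB//.
  have intd : mu.-integrable D (EFin \o (fun u => ipX (f u) h - ipX (S n u) h)).
    exact: integrable_subr.
  rewrite /= EFin_normr_Rintegral//.
  apply: (le_trans (le_abse_integral _ _ _)) => //; first by case/integrableP: intd.
  rewrite /e -ge0_integralZl//; last exact/measurable_EFinP/sm.
  apply: ge0_le_integral => //.
  - by apply: measurableT_comp => //; case/integrableP: intd.
  - by apply: measurable_funeM; exact/measurable_EFinP/sm.
  move=> u /= ut; rewrite lee_fin -ipBl mulrC.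
  exact: normr_ip.
have elim : (`|h|%:E * e n)%E @[n --> \oo] --> 0%E.
  by rewrite -(mule0 `|h|%:E); apply: cvgeZl.
apply/cvgrPdist_le => r r0.
move/fine_cvgP : elim => [efin /cvgrPdist_le/(_ _ r0)].
move: efin; apply: filterS2 => n efin /=.
rewrite sub0r normrN => he; rewrite -lee_fin (le_trans (bnd n))//.
rewrite -(fineK efin) lee_fin; exact/le_trans/he/ler_norm.
Qed.

End SimpleIntegral.

(** * Weak form of Bochner integrals of continuous functions *)

Section Bochner.
Context {R : realType} {X : normedModType R} (ipX : inner_product X).
Local Notation mu := (@lebesgue_measure R).

Lemma continuous_itv_integrable {f : R -> R} (a b : R) :
  continuous f -> mu.-integrable `[a, b] (EFin \o f).
Proof.
move=> cf; apply: continuous_compact_integrable; first exact: segment_compact.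
exact: continuous_subspaceT.
Qed.

(** The integrand [f] is controlled on [[0, t]] alone; [phi] is a globally continuous stand-in,
    which gives measurability and integrability of the paired function. *)
Lemma ip_bochner {t : R} {f phi : R -> X} {v} h :
  continuous phi -> {in `[0, t]%R, f =1 phi} -> has_bochner_integral t f v ->
  ipX v h = \int[mu]_(u in `[0, t]) ipX (phi u) h.
Proof.
move=> cphi fphi [s [sP sm slim svlim]].
have mI : measurable (`[0, t] : set R) by exact: measurable_itv.
have It : (lebesgue_measure (`[0%R, t] : set R) < +oo)%E.
  by rewrite lebesgue_measure_itv/=; case: ifP => // _; rewrite -EFinB ltry.
have cip : continuous (fun u => ipX (phi u) h).
  by move=> u; apply: cvg_ip; [exact: cphi|exact: cvg_cst].
have intf : mu.-integrable `[0, t] (EFin \o (fun u => ipX (f u) h)).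
  have := continuous_itv_integrable 0 t cip.
  by apply: eq_integrable => // u; rewrite inE/= => ut; rewrite fphi.
have -> := ip_simple_approx ipX _ _ intf sP sm slim svlim; [|exact: mI|exact: It].
by apply: eq_Rintegral => u; rewrite inE/= => ut; rewrite fphi.
Qed.

(** Paired with [h], the left side is the integral over []s, t]] of the pairing of [phi u - c] with
    [h], which is at most [e * |h|] pointwise; [norm_le_ip] then removes [h]. *)
Lemma bochner_increment {phi v : R -> X} {s t e : R} {c : X} :
  continuous phi ->
  (forall t h, 0 <= t -> ipX (v t) h = \int[mu]_(u in `[0, t]) ipX (phi u) h) ->
  0 <= s <= t -> (forall u, s <= u <= t -> `|phi u - c| <= e) ->
  `|v t - v s - (t - s) *: c| <= e * (t - s).
Proof.
move=> cphi vE /andP[s0 st] phic.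
have e0 : 0 <= e by rewrite (le_trans _ (phic s _)) ?lexx.
have ts0 : 0 <= t - s by rewrite subr_ge0.
apply: (norm_le_ip ipX) => [|h]; first exact: mulr_ge0.
have cip : continuous (fun u => ipX (phi u) h).
  by move=> u; apply: cvg_ip; [exact: cphi|exact: cvg_cst].
have mI : measurable (`]s, t] : set (measurableTypeR R)) by exact: measurable_itv.
have st0 : `]s, t] `<=` (`[0, t] : set R).
  by apply: subset_itv; rewrite bnd_simp.
have m0t : measurable (`[0, t] : set (measurableTypeR R)) by exact: measurable_itv.
have int0 : mu.-integrable `[0, t] (EFin \o (fun u => ipX (phi u) h)).
  exact: continuous_itv_integrable.
have int1 := integrableS m0t mI st0 int0.
have intc k : mu.-integrable `]s, t] (EFin \o cst k).
  apply: (integrableS m0t mI st0).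
  by apply: continuous_itv_integrable => u; exact: cvg_cst.
have intd := integrable_subr mI int1 (intc (ipX c h)).
have intn : mu.-integrable `]s, t] (EFin \o (fun u => `|ipX (phi u) h - ipX c h|)).
  exact: (integrable_norm intd).
have muI : fine (mu `]s, t]) = t - s.
  by rewrite lebesgue_measure_itv/= lte_fin; case: ltP => //= ?; lra.
rewrite !ipBl ipZl !vE ?(le_trans s0)//.
rewrite Rintegral_itvB ?bnd_simp//.
have cE k : (t - s) * k = \int[mu]_(_ in `]s, t]) k.
  by rewrite -muI mulrC -Rintegral_cst.
rewrite cE; have <- := RintegralB mI int1 (intc (ipX c h)).
rewrite (le_trans (le_normr_Rintegral mI intd))//.
rewrite mulrAC mulrC cE; apply: (le_Rintegral mI intn (intc (e * `|h|))).
move=> u /=; rewrite in_itv/= => /andP[su ut].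
rewrite -ipBl (le_trans (normr_ip _ _ _))// ler_wpM2r// phic//.
by rewrite ut ltW.
Qed.

End Bochner.

(** * Monotonicity, chain rule, and the fundamental theorem of calculus *)

Section RealDerivative.
Context {R : realType}.

(** Mean value theorem. Derivatives are requested on the open interval because the flow is
    differentiated at positive times. *)
Lemma le_of_derive_le0 {f df : R -> R} {a b : R} : a <= b -> continuous f ->
  (forall u, a < u < b -> is_derive u 1 f (df u)) ->
  (forall u, a < u < b -> df u <= 0) -> f b <= f a.
Proof.
move=> + cf fd df0; rewrite le_eqVlt => /predU1P[->//|ab].
have fd' u : u \in `]a, b[ -> is_derive u 1 f (df u) by rewrite in_itv/=; exact: fd.
have [c] := MVT ab fd' (continuous_subspaceT cf).
rewrite in_itv/= => cab fE; rewrite -subr_le0 fE.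
by rewrite mulr_le0_ge0 ?df0// subr_ge0 ltW.
Qed.

Lemma is_derive_diff_comp {X Y : normedModType R} {F : X -> Y} {x : R -> X}
    {t : R} {dx : X} :
  differentiable F (x t) -> is_derive t 1 x dx ->
  is_derive t 1 (F \o x) ('d F (x t) dx).
Proof.
move=> dF [xd xE].
have dx' : differentiable x t by apply/derivable1_diffP.
have dFx : differentiable (F \o x) t by exact: differentiable_comp.
split; first exact/derivable1_diffP.
by rewrite deriveE// diff_comp// -xE deriveE.
Qed.

End RealDerivative.

(** [bochner_increment] with [c = phi t]: continuity of [phi] at [t] makes [e] as small as desired,
    and dividing by [h] gives the difference quotient. *)
Lemma bochner_is_derive {R : realType} {X : normedModType R}
    (ipX : inner_product X) {phi v : R -> X} {t : R} :
  continuous phi ->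
  (forall t h, 0 <= t ->
     ipX (v t) h = \int[@lebesgue_measure R]_(u in `[0, t]) ipX (phi u) h) ->
  0 < t -> is_derive t 1 v (phi t).
Proof.
move=> cphi vE t0.
have lim : h^-1 *: ((v \o shift t) (h *: (1 : R)) - v t) @[h --> 0^'] --> phi t.
  apply/cvgrPdist_le => e e0.
  have /cvgrPdist_le /(_ _ e0) := cphi t.
  move=> /nbhs_ballP[d /= d0 dphi].
  (* The bound [d] serves continuity of [phi]; the bound [t] keeps [h + t] nonnegative, where [vE]
     applies. *)
  have m0 : 0 < Num.min d t by rewrite lt_min d0 t0.
  near=> h.
  have h0 : h != 0 by near: h; exact: nbhs_dnbhs_neq.
  have : `|h| < Num.min d t.
    near: h; apply: nbhs_dnbhs; apply/nbhs_ballP; exists (Num.min d t) => //= k.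
    by rewrite /ball/= sub0r normrN.
  rewrite lt_min => /andP[hd ht].
  have phie u : `|u - t| <= `|h| -> `|phi u - phi t| <= e.
    move=> uh; rewrite distrC; apply: dphi.
    by rewrite /ball/= distrC (le_lt_trans uh).
  have key : `|v (h + t) - v t - h *: phi t| <= e * `|h|.
    move: ht; rewrite ltr_norml => /andP[ht _].
    have [hp|hn] := ltP 0 h.
      rewrite (gtr0_norm hp) -[X in X *: _](addrK t h) -[X in _ * X](addrK t h).
      apply: (bochner_increment ipX cphi vE).
        by rewrite (ltW t0) lerDr ltW.
      move=> u /andP[tu uh]; apply: phie.
      by rewrite ger0_norm ?subr_ge0// lerBlDr (le_trans uh)// lerD2r ler_norm.
    have hE : t - (h + t) = - h by ring.
    rewrite (ler0_norm hn) -normrN opprB opprB addrC -[h *: _]opprK -scaleNr -hE.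
    apply: (bochner_increment ipX cphi vE).
      by apply/andP; split; lra.
    move=> u /andP[tu uh]; apply: phie.
    by rewrite (ler0_norm hn) ler_norml; apply/andP; split; lra.
  rewrite -(scalerK h0 (phi t)) -scalerBr normrZ normfV.
  rewrite ler_pdivrMl ?normr_gt0// mulrC distrC /= /GRing.scale/= mulr1.
  exact: key.
by split; [apply: cvgP lim | exact: cvg_lim lim].
Unshelve. all: by end_near. Qed.

(** * Convergence of the deterministic flow under the cone condition *)

Section LandweberFlow.
Context {R : realType} {X : completeNormedModType R} {Y : normedModType R}
  (ipX : inner_product X) (ipY : inner_product Y).
Context {F : X -> Y} {K : set X} {eta : R} {y : Y}.
Hypothesis dF : forall u, K u -> differentiable F u.
Hypotheses (eta_gt0 : 0 < eta) (eta_lt1 : eta < 1).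
Hypothesis cone : tangential_cone K F eta.

(** The negative gradient of half the squared residual. *)
Definition landweber_field (u : X) : X := adjoint ipX ipY ('d F u) (y - F u).

Lemma ip_landweber_field {u} h : K u ->
  ipX (landweber_field u) h = ipY ('d F u h) (y - F u).
Proof.
move=> Ku; rewrite ip_sym /landweber_field adjointP//.
exact/diff_continuous/dF.
Qed.

(** The linearised increment is the increment of [F] minus the cone remainder. When [F u = F u'],
    this puts [u' - u] in the null space of the derivative at [u]. *)
Lemma cone_norm_le {u u'} : K u -> K u' ->
  `|'d F u (u' - u)| <= (1 + eta) * `|F u - F u'|.
Proof.
move=> Ku Ku'; have := cone _ _ Ku Ku'.
set w := F u' - F u - _ => hw.
have -> : 'd F u (u' - u) = (F u' - F u) - w by rewrite subKr.
by rewrite (le_trans (ler_normB _ _))// mulrDl mul1r distrC lerD2l.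
Qed.

(** With [w] the cone remainder, ['d F u (u - z)] equals [w - (y - F u)]; the pairing with [w] costs
    at most the fraction [eta] of the squared residual. *)
Lemma cone_dissipative {u z} : K u -> K z -> F z = y ->
  ipY ('d F u (u - z)) (y - F u) <= - ((1 - eta) * `|y - F u| ^+ 2).
Proof.
move=> Ku Kz Fz; have := cone _ _ Ku Kz; rewrite Fz.
set w := y - F u - _ => hw.
have -> : 'd F u (u - z) = w - (y - F u).
  by rewrite -(opprB z) linearN/= /w addrAC subrr sub0r.
rewrite ipBl ip_norm.
have : ipY w (y - F u) <= eta * `|y - F u| ^+ 2.
  by rewrite (le_trans (ip_le _ _ _))// expr2 mulrA ler_wpM2r// -(distrC (F u)).
by move=> h1; lra.
Qed.

Context {x : R -> X} {z : X}.
Hypothesis xc : continuous x.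
Hypothesis Kx : forall t, K (x t).
Hypothesis dx : forall t : R, 0 < t -> is_derive t 1 x (landweber_field (x t)).
(** The pairing of [x t] with [h] has derivative [ipY ('d F (x t) h) (y - F (x t)) = 0]. The
    one-sided bound is applied to [h] and to [- h]. *)
Lemma flow_orthogonal {h : X} :
  (forall t : R, 0 < t -> 'd F (x t) h = 0) ->
  forall t : R, 0 <= t -> ipX (x t - x 0) h = 0.
Proof.
have le0 k : (forall t : R, 0 < t -> 'd F (x t) k = 0) ->
    forall t : R, 0 <= t -> ipX (x t - x 0) k <= 0.
  move=> k0 t t0; rewrite ipBl subr_le0.
  apply: (le_of_derive_le0 (f := fun s => ipX (x s) k) (df := cst 0) t0) => //.
  - by move=> s; apply: cvg_ip; [exact: xc|exact: cvg_cst].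
  - move=> s /andP[s0 _].
    apply: (is_derive_eq (is_derive_ip ipX (dx s s0) (is_derive_cst k s 1))).
    by rewrite ip0r addr0 ip_landweber_field// k0// ip0l.
move=> h0 t t0; apply/eqP; rewrite eq_le le0//= -oppr_le0 -mulN1r -ipZr le0//.
by move=> s s0; rewrite scaleN1r linearN/= h0// oppr0.
Qed.

Hypothesis Kz : K z.
Hypothesis Fz : F z = y.

Definition sqdist (t : R) : R := `|x t - z| ^+ 2.
Definition residual (t : R) : Y := y - F (x t).

Lemma is_derive_dist (t : R) : 0 < t ->
  is_derive t 1 (fun s => x s - z) (landweber_field (x t)).
Proof.
move=> t0; rewrite -[landweber_field _]subr0.
by have := dx t t0 => dxt; apply: is_deriveB.
Qed.

Lemma is_derive_sqdist (t : R) : 0 < t ->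
  is_derive t 1 sqdist (2 * ipX (landweber_field (x t)) (x t - z)).
Proof.
move=> t0; have -> : sqdist = (fun s => ipX (x s - z) (x s - z)).
  by apply/funext => s; rewrite ip_norm.
apply: (is_derive_eq (is_derive_ip ipX (is_derive_dist t t0) (is_derive_dist t t0))).
by rewrite (ip_sym ipX (x t - z)); ring.
Qed.

Lemma continuous_sqdist : continuous sqdist.
Proof.
move=> t; have -> : sqdist = (fun s => ipX (x s - z) (x s - z)).
  by apply/funext => s; rewrite ip_norm.
by apply: cvg_ip; apply: cvgB; [exact: xc|exact: cvg_cst|exact: xc|exact: cvg_cst].
Qed.

Lemma sqdist_dissipative (t : R) :
  ipX (landweber_field (x t)) (x t - z) <= - ((1 - eta) * `|residual t| ^+ 2).
Proof. by rewrite ip_landweber_field//; exact: cone_dissipative. Qed.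

Lemma continuous_residual : continuous residual.
Proof.
move=> t; apply: cvgB; first exact: cvg_cst.
by apply: continuous_comp; [exact: xc|exact/differentiable_continuous/dF].
Qed.

(** Along the gradient flow the squared residual has derivative [-2] times the squared norm of the
    field. *)
Lemma residual_nincr (s t : R) : 0 <= s <= t -> `|residual t| <= `|residual s|.
Proof.
move=> /andP[s0 st]; rewrite -(@ler_pXn2r _ 2)// ?nnegrE//.
pose f u := ipY (residual u) (residual u).
have -> : `|residual s| ^+ 2 = f s by rewrite /f ip_norm.
have -> : `|residual t| ^+ 2 = f t by rewrite /f ip_norm.
have ed (u : R) : 0 < u -> is_derive u 1 residual (- 'd F (x u) (landweber_field (x u))).
  move=> u0; have := is_derive_diff_comp (dF _ (Kx u)) (dx u u0) => d1.
  rewrite -[- _]add0r.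
  by apply: is_deriveB.
apply: (le_of_derive_le0 (df := fun u => - (2 * `|landweber_field (x u)| ^+ 2)) st).
- by move=> u; apply: cvg_ip; exact: continuous_residual.
- move=> u /andP[su _]; have u0 := le_lt_trans s0 su.
  apply: (is_derive_eq (is_derive_ip ipY (ed u u0) (ed u u0))).
  by rewrite (ip_sym ipY (residual u)) ipNl -ip_landweber_field// ip_norm; ring.
- by move=> u _; rewrite oppr_le0 mulr_ge0// exprn_ge0.
Qed.

Let eta1 : 0 < 1 - eta. Proof. by rewrite subr_gt0. Qed.

(** Chosen so that [cone_factor * (1 - eta) = 2 * (1 + eta)]: this multiple of the dissipation of
    [sqdist] pays for the cross term in [flow_increment_le]. *)
Definition cone_factor : R := 2 * (1 + eta) / (1 - eta).

Lemma cone_factor_ge0 : 0 <= cone_factor.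
Proof. by rewrite divr_ge0 ?(ltW eta1)// mulr_ge0// addr_ge0// ltW. Qed.

Lemma flow_increment_le (s t : R) : 0 <= s <= t ->
  `|x t - x s| ^+ 2 <= (cone_factor + 1) * (sqdist s - sqdist t).
Proof.
move=> /andP[s0 st].
(* Expanding [sqdist s] around [x t] leaves the cross term [ipX (x t - x s) (x t - z)]. Once [k] is
   nonincreasing, [k t <= k s] bounds it by [cone_factor / 2 * (sqdist s - sqdist t)]. *)
pose k u := ipX (x u - x t) (x t - z) + cone_factor / 2 * sqdist u.
have kd (u : R) : 0 < u -> is_derive u 1 k (ipX (landweber_field (x u)) (x t - z)
   + cone_factor / 2 * (2 * ipX (landweber_field (x u)) (x u - z))).
  move=> u0; apply: is_deriveD; last first.
    exact: (is_deriveZ (cone_factor / 2) (is_derive_sqdist u u0)).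
  have d1 : is_derive u 1 (fun v => x v - x t) (landweber_field (x u)).
    rewrite -[landweber_field _]subr0.
    by have := dx u u0 => dxu; apply: is_deriveB.
  apply: (is_derive_eq (is_derive_ip ipX d1 (is_derive_cst (x t - z) u 1))).
  by rewrite ip0r addr0.
have : k t <= k s.
  apply: (le_of_derive_le0 (df := fun u => ipX (landweber_field (x u)) (x t - z)
   + cone_factor / 2 * (2 * ipX (landweber_field (x u)) (x u - z))) st).
  - move=> u; apply: cvgD.
      by apply: cvg_ip; [apply: cvgB; [exact: xc|exact: cvg_cst]|exact: cvg_cst].
    by apply: cvgMr; exact: continuous_sqdist.
  - by move=> u /andP[su _]; apply: kd; exact: le_lt_trans su.
  move=> u /andP[su ut].
  have u0 := le_lt_trans s0 su.
  rewrite ip_landweber_field//.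
  (* The first part is bounded by the cone condition and [residual_nincr], as [u <= t]; the second
     is itself dissipative. *)
  have -> : x t - z = (x t - x u) + (x u - z) by rewrite addrA subrK.
  rewrite linearD/= ipDl -[X in _ + X + _](ip_landweber_field _ (Kx u)).
  have h1 := sqdist_dissipative u.
  have h2 : ipY ('d F (x u) (x t - x u)) (residual u) <= 2 * (1 + eta) * `|residual u| ^+ 2.
    rewrite (le_trans (ip_le _ _ _))// expr2 mulrA ler_wpM2r//.
    rewrite (le_trans (cone_norm_le (Kx u) (Kx t)))// -mulrA mulrCA.
    rewrite ler_wpM2l ?addr_ge0// ?(ltW eta_gt0)//.
    have -> : F (x u) - F (x t) = residual t - residual u.
      by rewrite /residual opprB [RHS]addrC addrA subrK.
    rewrite (le_trans (ler_normB _ _))// mulr_natl mulr2n lerD2r residual_nincr//.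
    by rewrite (ltW u0) ltW.
  have CE : cone_factor * ((1 - eta) * `|residual u| ^+ 2) =
      2 * (1 + eta) * `|residual u| ^+ 2.
    by rewrite mulrA /cone_factor divfK// subr_eq0 gt_eqF.
  have := ler_wpM2l cone_factor_ge0 h1; rewrite mulrN CE => h3.
  have q0 : 0 <= (1 - eta) * `|residual u| ^+ 2 by rewrite mulr_ge0 ?exprn_ge0// ltW.
  have -> : cone_factor / 2 * (2 * ipX (landweber_field (x u)) (x u - z)) =
    cone_factor * ipX (landweber_field (x u)) (x u - z) by field.
  by move: h2 h1 h3 q0; rewrite /residual; clear k kd; move=> *; lra.
have : sqdist s = sqdist t - 2 * ipX (x t - x s) (x t - z) + `|x t - x s| ^+ 2.
  rewrite /sqdist -!(ip_norm ipX) !ipBl !ipBr.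
  by rewrite (ip_sym ipX (x s) z) (ip_sym ipX (x t) z) (ip_sym ipX (x s) (x t)); ring.
rewrite /k subrr ip0l add0r -(opprB (x t)) ipNl; clear k kd.
by move=> h1 h2; lra.
Qed.

(** The residual on []0, t[] is at least its value at [t], so [sqdist] falls at least at the
    constant rate [c] there, while staying nonnegative. *)
Lemma residual_decay (t : R) : 0 < t -> t * `|residual t| ^+ 2 <= sqdist 0 / (2 * (1 - eta)).
Proof.
move=> t0; have eta2 : 0 < 2 * (1 - eta) by rewrite mulr_gt0.
have [c cE] : exists c, c = 2 * (1 - eta) * `|residual t| ^+ 2 by eexists.
rewrite ler_pdivlMr//.
have : sqdist t + c * t <= sqdist 0 + c * 0.
  apply: (le_of_derive_le0 (f := fun s => sqdist s + c * s)
    (df := fun u => 2 * ipX (landweber_field (x u)) (x u - z) + c * 1) (ltW t0)).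
  - move=> u; apply: cvgD; first exact: continuous_sqdist.
    by apply: cvgMr; exact: cvg_id.
  - move=> u /andP[u0 _]; exact: (is_deriveD (is_derive_sqdist u u0)
      (is_deriveZ c (is_derive_id u (1 : R)))).
  move=> u /andP[u0 ut]; have := sqdist_dissipative u.
  have : `|residual t| ^+ 2 <= `|residual u| ^+ 2.
    by rewrite lerXn2r ?nnegrE// residual_nincr// (ltW u0) ltW.
  rewrite cE => h1 h2.
  have h3 : (1 - eta) * `|residual t| ^+ 2 <= (1 - eta) * `|residual u| ^+ 2.
    by rewrite ler_wpM2l// ltW.
  by lra.
rewrite mulr0 addr0; apply: le_trans.
rewrite (_ : t * _ * _ = c * t); last by rewrite cE; ring.
by rewrite lerDr exprn_ge0.
Qed.

(** Choose [T] with [sqdist T] within [r ^+ 2 / (cone_factor + 1)] of the infimum of [sqdist]; by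
    [flow_increment_le] all later points lie within [r] of [x T]. *)
Lemma flow_is_cvg : cvg (x t @[t --> +oo]).
Proof.
have C0 : 0 < cone_factor + 1 by rewrite ltr_wpDl// cone_factor_ge0.
apply: cauchy_cvg; apply: cauchy_exP => r r0.
pose W := [set sqdist t | t in [set t : R | 0 <= t]].
have Winf : has_inf W.
  by split; [exists (sqdist 0), 0 => /=|exists 0 => _ [t _ <-]; exact: exprn_ge0].
have r1 : 0 < r ^+ 2 / (cone_factor + 1) by rewrite divr_gt0// exprn_gt0.
have [_ [T T0 <-] VT] := inf_adherent r1 Winf.
exists (x T); exists T; split; first exact: num_real.
move=> t Tt; rewrite -ball_normE/= distrC.
rewrite -(@ltr_pXn2r _ 2)// ?nnegrE//; last exact: ltW.
have T0t : 0 <= T <= t by rewrite (ltW Tt) andbT.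
rewrite (le_lt_trans (flow_increment_le T t T0t))//.
rewrite mulrC -ltr_pdivlMr//.
have : inf W <= sqdist t.
  by apply: ge_inf; [exact: Winf.2|exists t => //=; rewrite (le_trans T0)// ltW].
by move=> h1; lra.
Qed.

Lemma landweber_flow_cvg : closed K ->
  exists xstar, [/\ K xstar, F xstar = y & x t @[t --> +oo] --> xstar].
Proof.
move=> cK; exists (lim (x t @[t --> +oo])).
set xs := lim _.
have xxs : x t @[t --> +oo] --> xs by exact: flow_is_cvg.
have Kxs : K xs.
  by apply: (closed_cvg K cK _ _ xxs); exact: nearW.
split => //; apply/eqP; rewrite eq_sym -subr_eq0 -normr_eq0 -sqrf_eq0; apply/eqP.
have elim : `|residual t| ^+ 2 @[t --> +oo] --> `|y - F xs| ^+ 2.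
  rewrite -(ip_norm ipY); under eq_fun do rewrite -(ip_norm ipY).
  have eF : residual t @[t --> +oo] --> y - F xs.
    apply: cvgB; first exact: cvg_cst.
    by apply: (cvg_comp x F xxs); exact/differentiable_continuous/dF.
  exact: cvg_ip.
apply: (cvg_unique _ elim) => //.
apply/cvgrPdist_le => r r0.
have eta2 : 0 < 2 * (1 - eta) by rewrite mulr_gt0.
(* Beyond this time the bound of [residual_decay], divided by [t], is below [r]. *)
exists (sqdist 0 / (2 * (1 - eta)) / r); split; first exact: num_real.
move=> t; rewrite ltr_pdivrMr// => Vt.
have V0 : 0 <= sqdist 0 / (2 * (1 - eta)) by rewrite divr_ge0 ?exprn_ge0// ltW.
have t0 : 0 < t by rewrite -(pmulr_lgt0 _ r0) (le_lt_trans V0).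
rewrite sub0r normrN ger0_norm ?exprn_ge0// -(ler_pM2l t0).
by rewrite (le_trans (residual_decay t t0))// ltW.
Qed.

End LandweberFlow.

(** * From the integral equation of one path to the differential equation *)

Section Trajectory.
Context {R : realType} {X : completeNormedModType R} {Y : normedModType R}
  (ipX : inner_product X) (ipY : inner_product Y).
Context {F : X -> Y} {K : set X} {y : Y}.
Hypothesis F_C1 : continuous_derivative_on K F.

Local Notation A := (landweber_field ipX ipY (F := F) (y := y)).

Let dF {u} : K u -> differentiable F u. Proof. exact: F_C1.1. Qed.

(** After pairing with [h], a mixed term is inserted to separate the change of the derivative from
    the change of the residual. *)
Lemma landweber_fieldB_le {u v : X} : K u -> K v ->
  `|A u - A v| <= opnorm (fun h => 'd F u h - 'd F v h) * `|y - F u|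
    + opnorm ('d F v) * `|F v - F u|.
Proof.
move=> Ku Kv.
have [M1 HM1] := continuous_linear_bound (diff_continuous (dF Ku)).
have [M2 HM2] := continuous_linear_bound (diff_continuous (dF Kv)).
have dB h : `|'d F u h - 'd F v h| <= opnorm (fun h => 'd F u h - 'd F v h) * `|h|.
  apply: (le_opnorm (L := fun h => 'd F u h - 'd F v h)).
    move=> a w; have Z (L : {linear X -> Y}) : L (a *: w) = a *: L w by rewrite linearZ.
    by rewrite !Z scalerBr.
  exists (M1 + M2) => w w1; rewrite (le_trans (ler_normB _ _))// lerD//.
    exact: HM1.
  exact: HM2.
have dv h : `|'d F v h| <= opnorm ('d F v) * `|h|.
  by apply: le_opnorm; [move=> a w; rewrite linearZ|exists M2].
apply: (norm_le_ip ipX) => [|h].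
  by rewrite addr_ge0// mulr_ge0// opnorm_ge0.
rewrite ipBl (ip_landweber_field ipX ipY F_C1.1 h Ku) (ip_landweber_field ipX ipY F_C1.1 h Kv).
have ipBB a b k l : ipY a k - ipY b l = ipY (a - b) k + ipY b (k - l).
  by rewrite ipBl ipBr addrA subrK.
have -> : F v - F u = (y - F u) - (y - F v) by rewrite opprB [RHS]addrC addrA subrK.
rewrite ipBB.
rewrite (le_trans (ler_normD _ _))// mulrDl lerD//.
  by rewrite (le_trans (normr_ip _ _ _))// mulrAC ler_wpM2r.
by rewrite (le_trans (normr_ip _ _ _))// mulrAC ler_wpM2r.
Qed.

Lemma continuous_landweber_field {x : R -> X} :
  continuous x -> (forall t, K (x t)) -> continuous (fun t => A (x t)).
Proof.
move=> xc Kx t.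
have Fx : F (x s) @[s --> t] --> F (x t).
  by apply: continuous_comp; [exact: xc|exact/differentiable_continuous/dF].
have lim : opnorm (fun h => 'd F (x s) h - 'd F (x t) h) * `|y - F (x s)|
    + opnorm ('d F (x t)) * `|F (x t) - F (x s)| @[s --> t] --> (0 : R).
  rewrite -[X in _ --> X]addr0; apply: cvgD.
    rewrite -[X in _ --> X](mul0r `|y - F (x t)|); apply: cvgM.
      (* The derivative is continuous relative to [K], and the curve never leaves [K]. *)
      have xK : x s @[s --> t] --> within K (nbhs (x t)).
        move=> B HB; have h0 : \forall s \near t, K (x s) -> B (x s) := xc t _ HB.
        suff : \forall s \near t, B (x s) by [].
        by apply: filterS h0 => s h; exact: (h (Kx s)).
      exact: (cvg_comp x (fun z => opnorm (fun h => 'd F z h - 'd F (x t) h))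
        xK (F_C1.2 _ (Kx t))).
    by apply: cvg_norm; apply: cvgB; [exact: cvg_cst|exact: Fx].
  rewrite -[X in _ --> X](mulr0 (opnorm ('d F (x t)))); apply: cvgMr.
  rewrite -[X in _ --> X](normr0 Y) -(subrr (F (x t))).
  by apply: cvg_norm; apply: cvgB; [exact: cvg_cst|exact: Fx].
apply/cvgrPdist_le => e e0.
move/cvgrPdist_le : lim => /(_ _ e0); apply: filterS => s.
rewrite sub0r normrN => h1; rewrite distrC (le_trans (landweber_fieldB_le (Kx s) (Kx t)))//.
exact/le_trans/h1/ler_norm.
Qed.

Context {x S : R -> X} {xbar : X}.
Hypothesis xc : {within `[0, +oo[, continuous x}.
Hypothesis Kx : forall t : R, 0 <= t -> K (x t).
Hypothesis xint : forall t : R, 0 <= t ->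
  has_bochner_integral t (fun s => A (x s)) (x t - xbar - S t).
Hypothesis S_rat : forall q : rat, 0 <= ratr q :> R -> S (ratr q) = 0.

(* [x] frozen at its initial value for negative times, so that one-sided limits
   at [0] need no separate treatment. *)
Definition extend_left (t : R) : X := x (Num.max 0 t).

Lemma extend_leftE {t : R} : 0 <= t -> extend_left t = x t.
Proof. by move=> t0; rewrite /extend_left max_r. Qed.

Lemma continuous_extend_left : continuous extend_left.
Proof.
move=> t; move/subspace_continuousP : xc => /(_ (Num.max 0 t)).
rewrite /= in_itv/= andbT le_max lexx => /(_ isT) xt.
apply: (cvg_comp (Num.max 0) x _ xt) => B HB.
have mt : Num.max 0 s @[s --> t] --> Num.max 0 t.
  by apply: (@continuous_max _ _ (cst 0) id); [exact: cst_continuous|exact: cvg_id].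
have h0 : \forall s \near t, `[0, +oo[%classic (Num.max 0 s) -> B (Num.max 0 s) := mt _ HB.
suff : \forall s \near t, B (Num.max 0 s) by [].
by apply: filterS h0 => s; apply; rewrite /= in_itv/= andbT le_max lexx.
Qed.

Lemma extend_left_in (t : R) : K (extend_left t).
Proof. by apply: Kx; rewrite le_max lexx. Qed.

Lemma continuous_field_extend_left : continuous (fun s => A (extend_left s)).
Proof. exact: continuous_landweber_field continuous_extend_left extend_left_in. Qed.

Let v (t : R) :=  x t - xbar - S t.

(** Stated for [v], the Bochner integral part of the path, because [S] is so far known to vanish at
    rational times only. *)
Lemma is_derive_trajectory {t : R} : 0 < t -> is_derive t 1 v (A (x t)).
Proof.
move=> t0; rewrite -(extend_leftE (ltW t0)).
apply: (bochner_is_derive ipX (phi := fun s => A (extend_left s))) => //.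
  exact: continuous_field_extend_left.
move=> s h s0; apply: (ip_bochner ipX h _ _ (xint s s0)).
  exact: continuous_field_extend_left.
by move=> u; rewrite in_itv/= => /andP[u0 _]; rewrite extend_leftE.
Qed.

(** At positive times [S] is a difference of the continuous path and the differentiable [v], hence
    continuous, and it vanishes on the dense rationals. Time 0 is itself rational. *)
Lemma drift_eq0 {t : R} : 0 <= t -> S t = 0.
Proof.
rewrite le_eqVlt => /predU1P[<-|t0].
  by rewrite -(rmorph0 (@ratr R)) S_rat// rmorph0.
apply/eqP/negPn/negP => St.
have xct : {for t, continuous extend_left} by exact: continuous_extend_left.
have vct : {for t, continuous v}.
  apply/differentiable_continuous/derivable1_diffP.
  by case: (is_derive_trajectory t0).
pose D s := extend_left s - xbar - v s.
have Dc : {for t, continuous D}.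
  by apply: cvgB => //; apply: cvgB => //; exact: cvg_cst.
have DS s : 0 <= s -> D s = S s.
  by move=> s0; rewrite /D extend_leftE// /v opprB addrC subrK.
have Dt : `|D s| @[s --> t] --> `|S t| by rewrite -DS ?ltW//; exact: cvg_norm.
have St0 : 0 < `|S t| by rewrite normr_gt0.
have : \forall s \near t, 0 < `|D s| by exact: (cvgr_gt _ Dt).
have : \forall s \near t, 0 < s by exact: lt_nbhsr.
move=> tp Dp; have : nbhs t [set s | 0 < s /\ 0 < `|D s|] by exact: filterI tp Dp.
move=> /nbhs_ballP[e /= e0 He].
have oB : open (ball t e) by exact: ball_open.
have [p [te [q _ qp]]] := @dense_rat R (ball t e) (ex_intro _ t (ballxx t e0)) oB.
move: te; rewrite -qp => te.
have [q0] := He _ te.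
by rewrite DS ?ltW// S_rat ?ltW// normr0 ltxx.
Qed.

(** The integral over [[0, 0]] is 0; it is paired with [x 0 - xbar] itself. *)
Lemma initial_value : x 0 = xbar.
Proof.
have fE : {in `[(0 : R), 0], (fun s => A (x s)) =1 (fun s => A (extend_left s))}.
  by move=> u; rewrite in_itv/= => /andP[u0 _]; rewrite extend_leftE.
have := ip_bochner ipX (x 0 - xbar) continuous_field_extend_left fE (xint 0 (lexx 0)).
rewrite drift_eq0// subr0 ip_norm set_itv1 Rintegral_set1 => /eqP.
by rewrite sqrf_eq0 normr_eq0 subr_eq0 => /eqP.
Qed.

Lemma is_derive_extend_left {t : R} : 0 < t ->
  is_derive t 1 extend_left (A (extend_left t)).
Proof.
move=> t0; rewrite [in A _]extend_leftE ?ltW//.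
have -> : A (x t) = A (x t) + 0 by rewrite addr0.
have dv := is_derive_trajectory t0.
have : is_derive t 1 (fun s => v s + xbar) (A (x t) + 0) by exact: is_deriveD.
apply: near_eq_is_derive; near=> s.
have s0 : 0 <= s by apply: ltW; near: s; exact: lt_nbhsr.
by rewrite extend_leftE// /v drift_eq0// subr0 subrK.
Unshelve. all: by end_near. Qed.

End Trajectory.

(** * Almost sure statements, measurability, and the vanishing Ito integral *)

Section AlmostEverywhere.
Context {R : realType} {d : measure_display} {Omega : measurableType d}
  {P : probability Omega R}.

Lemma ae_forall_countable {I : countType} (Q : I -> Omega -> Prop) :
  (forall i, {ae P, forall w, Q i w}) -> {ae P, forall w, forall i, Q i w}.
Proof.
move=> QP.
have : P.-negligible (\bigcup_n
    [set w | exists2 i, pickle_inv n = Some i & ~ Q i w]).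
  apply: negligible_bigcup => n.
  case ni : (pickle_inv n) => [i|].
    apply: negligibleS (QP i) => w [j] [<-]; exact.
  by apply: negligibleS (negligible_set0 P) => w [].
apply: negligibleS => w /= /existsNP[i Qi].
by exists (pickle i) => //; exists i => //; rewrite pickleK_inv.
Qed.

Lemma borel_measurable_fun {X : topologicalType} {Z : Omega -> X} {f : X -> R} :
  borel_measurable (@measurable _ Omega) Z -> continuous f ->
  measurable_fun setT (f \o Z).
Proof.
move=> mZ /continuousP cf; apply: (measurability _ (RGenOpens.measurableE R)).
move=> _ [_ [a [b ->] <-]]; rewrite setTI.
exact/(mZ (f @^-1` `]a, b[%classic))/cf/interval_open.
Qed.

Lemma continuous_sqr_dist {X : normedModType R} (c : X) :
  continuous (fun u : X => `|u - c| ^+ 2).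
Proof.
move=> u; apply: (cvg_comp (fun u : X => `|u - c|) (fun a : R => a ^+ 2)).
  by apply: cvg_norm; apply: cvgB; [exact: cvg_id|exact: cvg_cst].
exact: exprn_continuous.
Qed.

Lemma expectation_ae_cst (f : Omega -> R) (k : R) :
  measurable_fun setT f -> {ae P, forall w, f w = k} -> expectation P f = k%:E.
Proof.
move=> mf fk; rewrite -(expectation_cst P k) unlock.
apply: ae_eq_integral => //; [exact/measurable_EFinP|exact/measurable_EFinP/measurable_cst|].
by apply: filterS fk => w /= ->.
Qed.

Lemma expectation_sqr_norm_eq0 {X : normedModType R} {Z : Omega -> X} :
  borel_measurable (@measurable _ Omega) Z ->
  expectation P (fun w => `|Z w| ^+ 2) = 0%E -> {ae P, forall w, Z w = 0}.
Proof.
move=> mZ; rewrite unlock => Z0.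
have mZ2 : measurable_fun setT (fun w => `|Z w| ^+ 2).
  under eq_fun do rewrite -(subr0 (Z _)).
  exact: (borel_measurable_fun mZ (continuous_sqr_dist 0)).
have : ae_eq P setT (fun w => (`|Z w| ^+ 2)%:E) (cst 0%E).
  apply/ae_eq_integral_abs => //; first exact/measurable_EFinP.
  by under eq_integral do rewrite gee0_abs ?lee_fin ?exprn_ge0//.
apply: filterS => w /(_ I) [] /eqP.
by rewrite sqrf_eq0 normr_eq0 => /eqP.
Qed.

(** The empty list of steps approximates the zero integrand exactly and has integral 0, so the
    second moment of [S] is the limit of a constant sequence tending to 0. *)
Lemma wiener_integral0 {X : normedModType R} {B : R -> Omega -> X} {t : R}
    {S : Omega -> X} :
  is_wiener_integral P B t (fun=> 0) S -> {ae P, forall w, S w = 0}.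
Proof.
move=> [mS _ _ SP]; apply: (expectation_sqr_norm_eq0 mS).
have SE : (fun w => `|S w - step_int B [::] w| ^+ 2) = (fun w => `|S w| ^+ 2).
  by apply/funext => w; rewrite /step_int big_nil subr0.
have lim : expectation P (fun w => `|S w| ^+ 2) @[_ --> \oo] --> 0%E.
  rewrite -SE; apply: (SP (fun=> [::])) => //.
  under eq_fun do under eq_integral do rewrite /step_val big_nil subr0 expr0n/=.
  under eq_fun do rewrite integral0.
  exact: cvg_cst.
apply: (cvg_unique _ (cvg_cst _) lim) => //.
Qed.

Lemma adapted_borel {X : topologicalType} {Fil : R -> set (set Omega)}
    {Z : R -> Omega -> X} {t : R} :
  filtration Fil -> adapted Fil Z -> 0 <= t ->
  borel_measurable (@measurable _ Omega) (Z t).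
Proof. by move=> [FilP _] aZ t0 U oU; apply: (FilP t t0).2; exact: aZ. Qed.

Lemma adapted_cst {X : topologicalType} {Fil : R -> set (set Omega)}
    (z : R -> X) :
  filtration Fil -> adapted Fil (fun t (_ : Omega) => z t).
Proof.
move=> [FilP _] t t0 U oU; have [[F0 FC _] _] := FilP t t0.
have [Uz|Uz] := pselect (U (z t)).
  have -> : (fun _ : Omega => z t) @^-1` U = setT `\` set0.
    by rewrite setD0; apply/seteqP; split.
  exact: FC.
suff -> : (fun _ : Omega => z t) @^-1` U = set0 by [].
by apply/seteqP; split.
Qed.

End AlmostEverywhere.

(** * Reduction to one deterministic path *)

Lemma exact_data_solution_deterministic
    {R : realType} {X Y : completeNormedModType R}
    {ipX : inner_product X} {ipY : inner_product Y}
    {F : X -> Y} {xbar : X} {r : R} {y : Y} {g : R -> R}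
    {d : measure_display} {Omega : measurableType d} {P : probability Omega R}
    {Fil : R -> set (set Omega)} {B x : R -> Omega -> X} :
  filtration Fil -> continuous_derivative_on (closed_ball xbar r) F ->
  the_sar_solution P ipX ipY Fil B F xbar r g 0 y x ->
  exists z : R -> X,
    [/\ {within `[0, +oo[, continuous z},
        forall t, 0 <= t -> closed_ball xbar r (z t),
        forall t, 0 <= t -> has_bochner_integral t
          (fun s => landweber_field ipX ipY (F := F) (y := y) (z s)) (z t - xbar - 0) &
        {ae P, forall w, forall t, 0 <= t -> x t w = z t}].
Proof.
move=> FilP F_C1 [[xa xc xK [S [SP xint]]] uniq].
have noise0 : noise_intensity P F 0 y g x = fun=> 0.
  by apply/funext => t; rewrite /noise_intensity !mul0r.
(* Each time has its own exceptional null set; countably many times can share one, and path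
   regularity then covers the rest. *)
have S_rat : {ae P, forall w, forall q : rat, 0 <= ratr q :> R -> S (ratr q) w = 0}.
  apply: ae_forall_countable => q.
  have [q0|q0] := pselect (0 <= ratr q :> R); last by apply: aeW => w /q0.
  have := SP _ q0; rewrite noise0 => /wiener_integral0.
  by apply: filterS => w ->.
have S0 : {ae P, forall w, forall t, 0 <= t -> S t w = 0}.
  apply: filterS2 (filterI xc xK) (filterI xint S_rat) => w [xcw xKw] [xiw Sw] t t0.
  exact: (drift_eq0 ipX ipY F_C1 (S := S^~ w) xcw xKw xiw Sw t0).
(* Positive total mass makes the almost-everywhere filter proper, so an outcome with all the good
   properties exists. *)
have PT : (0 < P [set: Omega])%E by rewrite probability_setT.
have PF := ae_properfilter_algebraOfSetsType PT.
have [w [[xcw xKw] [xiw Sw]]] := filter_ex (filterI (filterI xc xK) (filterI xint S0)).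
exists (x^~ w); split => //.
  by move=> t t0; rewrite -(Sw t t0); exact: xiw.
apply: (uniq (fun t _ => x t w)); split.
- exact: (adapted_cst (x^~ w) FilP).
- exact: aeW.
- exact: aeW.
exists S; split.
  move=> t t0; have := SP t t0.
  rewrite noise0 (_ : noise_intensity _ _ _ _ _ _ = fun=> 0)//.
  by apply/funext => s; rewrite /noise_intensity !mul0r.
apply: filterS S0 => w' S0 t t0.
by rewrite S0// -(Sw t t0); exact: xiw.
Qed.

(** For [t >= 0] the expectation is the number [|z t - c| ^+ 2], so mean square convergence reduces
    to convergence of one path. *)
Lemma cvg_expectation_sqr_dist {R : realType} {X : normedModType R}
    {d : measure_display} {Omega : measurableType d} {P : probability Omega R}
    {x : R -> Omega -> X} {z : R -> X} {c : X} :
  (forall t, 0 <= t -> borel_measurable (@measurable _ Omega) (x t)) ->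
  {ae P, forall w, forall t, 0 <= t -> x t w = z t} ->
  z t @[t --> +oo] --> c ->
  expectation P (fun w => `|x t w - c| ^+ 2) @[t --> +oo] --> 0%E.
Proof.
move=> mx xz zc.
have zc0 : (`|z t - c| ^+ 2)%:E @[t --> +oo] --> 0%E.
  apply: cvg_EFin; first by near=> t.
  have := cvg_comp z _ zc (continuous_sqr_dist c c).
  by rewrite subrr normr0 expr0n.
apply: cvg_trans zc0; apply: near_eq_cvg; near=> t.
have t0 : 0 <= t by near: t; exact: nbhs_pinfty_ge.
apply/esym/expectation_ae_cst.
  exact: (borel_measurable_fun (mx t t0) (continuous_sqr_dist c)).
by apply: filterS xz => w /(_ t t0) ->.
Unshelve. all: by end_near. Qed.

(** * Mean square convergence and identification of the limit *)

Theorem theorem3p7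
  (R : realType) (X Y : completeNormedModType R)
  (ipX : inner_product X) (ipY : inner_product Y)
  (sepX : separable X) (sepY : separable Y)
  (* the operator, the initial guess and the exact data *)
  (D : set X) (F : X -> Y) (xbar : X) (r : R) (y : Y) (xdag : X)
  (r_gt0 : 0 < r)
  (ball_D : closed_ball xbar r `<=` D)
  (xdagP : unique_min_distance_solution D F y xbar xdag)
  (xdag_ball : closed_ball xbar r xdag)
  (* (i) *)
  (F_cont : {within D, continuous F})
  (F_C1 : continuous_derivative_on (closed_ball xbar r) F)
  (dF_le1 : forall x, closed_ball xbar r x -> opnorm ('d F x) <= 1)
  (* (ii) *)
  (eta : R) (eta01 : 0 < eta < 1)
  (F_cone : tangential_cone (closed_ball xbar r) F eta)
  (* the noise *)
  (delta0 eps0 : R) (delta0_gt0 : 0 < delta0)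
  (eps0P : 0 < eps0 < 2 * (1 / eta - 1))
  (g : R -> R)
  (g_decr : forall s t, 0 <= s -> s <= t -> g t <= g s)
  (g_lim : g t @[t --> +oo] --> (0 : R))
  (g0 : g 0 = Num.sqrt (eps0 * eta) / delta0)
  (d : measure_display) (Omega : measurableType d) (P : probability Omega R)
  (Fil : R -> set (set Omega)) (FilP : filtration Fil)
  (Q : {linear X -> X}) (J : set nat) (lambda : nat -> R) (phi : nat -> X)
  (beta : nat -> R -> Omega -> R) (B : R -> Omega -> X)
  (BP : q_wiener_process P ipX Fil Q J lambda phi beta B)
  (* the solution for exact data *)
  (x : R -> Omega -> X)
  (xP : the_sar_solution P ipX ipY Fil B F xbar r g 0 y x) :
  (exists xstar : X, is_solution D F y xstar /\
     expectation P (fun w => `|x t w - xstar| ^+ 2) @[t --> +oo] --> 0%E) /\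
  ({ae P, forall w, forall t, 0 < t ->
      null_space ('d F xdag) `<=` null_space ('d F (x t w))} ->
   expectation P (fun w => `|x t w - xdag| ^+ 2) @[t --> +oo] --> 0%E).
Proof.
have [eta_gt0 eta_lt1] := andP eta01.
have [z [zc Kz zint xz]] := exact_data_solution_deterministic FilP F_C1 xP.
pose K := closed_ball xbar r.
have clK : closed K by exact: closed_ball_closed.
have dF : forall u, K u -> differentiable F u := F_C1.1.
have [[_ Fxdag] xdag_min] := xdagP.
have drift0 (q : rat) : 0 <= ratr q :> R -> (fun=> 0 : X) (ratr q : R) = 0 by [].
have mx (t : R) : 0 <= t -> borel_measurable (@measurable _ Omega) (x t).
  exact: (adapted_borel FilP xP.1.(sar_adapted)).
pose zz := extend_left (x := z).
have zzc : continuous zz := continuous_extend_left zc.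
have Kzz (t : R) : K (zz t) := extend_left_in Kz t.
have dzz (t : R) : 0 < t ->
    is_derive t 1 zz (landweber_field ipX ipY (F := F) (y := y) (zz t)).
  exact: (is_derive_extend_left ipX ipY F_C1 zc Kz zint drift0).
(* The reference solution in the ball, from which distances are measured, is [xdag]. *)
have [xs [Kxs Fxs zzxs]] := landweber_flow_cvg ipX ipY dF eta_gt0 eta_lt1 F_cone
  zzc Kzz dzz xdag_ball Fxdag clK.
have zxs : z t @[t --> +oo] --> xs.
  apply: cvg_trans zzxs; apply: near_eq_cvg; near=> t.
  by rewrite /zz extend_leftE//; near: t; exact: nbhs_pinfty_ge.
have Ex := cvg_expectation_sqr_dist mx xz zxs.
split; first by exists xs; split => //; split => //; exact: ball_D.
move=> nullP; suff <- : xs = xdag by [].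
have PT : (0 < P [set: Omega])%E by rewrite probability_setT.
have PF := ae_properfilter_algebraOfSetsType PT.
(* One outcome on which [x] follows [z] carries the null space inclusion over to the deterministic
   path. *)
have [w [xzw nullw]] := filter_ex (filterI xz nullP).
have dz0 h (t : R) : 'd F xdag h = 0 -> 0 < t -> 'd F (zz t) h = 0.
  by move=> h0 t0; rewrite /zz extend_leftE ?ltW// -xzw ?ltW//; exact: nullw.
have zz0 : zz 0 = xbar.
  by rewrite /zz extend_leftE//; exact: (initial_value ipX ipY F_C1 zc Kz zint drift0).
have h0 : 'd F xdag (xs - xdag) = 0.
  apply/eqP; rewrite -normr_le0.
  have := cone_norm_le F_cone xdag_ball Kxs.
  by rewrite Fxs Fxdag subrr normr0 mulr0.
have orth : ipX (xs - xbar) (xs - xdag) = 0.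
  have lim : ipX (zz t - zz 0) (xs - xdag) @[t --> +oo] --> ipX (xs - xbar) (xs - xdag).
    by rewrite zz0; apply: cvg_ip; [apply: cvgB; [|exact: cvg_cst]|exact: cvg_cst].
  apply: (cvg_unique _ lim) => //.
  apply: cvg_near_cst; near=> t.
  have t0 : 0 <= t by near: t; exact: nbhs_pinfty_ge.
  exact: (flow_orthogonal ipX ipY dF zzc Kzz dzz (fun s => dz0 _ s h0)).
have xsb : `|xs - xbar| <= `|xdag - xbar|.
  (* By [orth], [xs - xbar] has the same pairing with [xdag - xbar] as with itself; Cauchy-Schwarz
     finishes. *)
  have : `|xs - xbar| ^+ 2 <= `|xs - xbar| * `|xdag - xbar|.
    rewrite -(ip_norm ipX).
    have -> : ipX (xs - xbar) (xs - xbar) = ipX (xs - xbar) (xdag - xbar).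
      by apply/eqP; rewrite -subr_eq0 -ipBr opprB addrA subrK orth.
    exact: ip_le.
  have [->|n0] := eqVneq `|xs - xbar| 0; first by [].
  by rewrite expr2 ler_pM2l// lt_neqAle eq_sym n0 /=.
apply/eqP/negPn/negP => /eqP xsneq.
have := xdag_min xs (conj (ball_D _ Kxs) Fxs) xsneq.
by rewrite ltNge xsb.
Unshelve. all: by end_near. Qed.
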